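(* Let $X$ be a zero-dimensional topological space. The following are equivalent: (1) $C_p(X)$ has the Reznichenko property. (2) Each clopen $\omega$-cover of $X$ contains a countable $\omega$-cover of $X$; and no continuous image of $X$ in $[\mathbb{N}]^{\aleph_0}$ is a subbase for a nonfeeble filter. (3) Each clopen $\omega$-cover of $X$ contains an $\omega$-groupable cover of $X$.
   Context: For a topological space $X$, $C_p(X)$ is the set of all continuous functions $f:X\to\mathbb{R}$ with the subspace topology inherited from the Tychonoff product $\mathbb{R}^X$. A space is zero-dimensional if it has a base consisting of clopen sets. A space $Y$ has the Reznichenko property if for each $A\subseteq Y$ and each $y\in\overline{A}\setminus A$ there are pairwise disjoint finite sets $F_n\subseteq A$, $n\in\mathbb{N}$, such that each neighborhood of $y$ intersects all but finitely many of the sets $F_n$. A family $\mathcal{U}$ of subsets of $X$ is an $\omega$-cover of $X$ if $X\notin\mathcal{U}$ but each finite $F\subseteq X$ is contained in some $U\in\mathcal{U}$. It is a clopen $\omega$-cover if all its members are clopen in $X$. A cover $\mathcal{U}$ of $X$ is $\omega$-groupable if there is a partition $\mathcal{P}$ of $\mathcal{U}$ into finite pieces such that for each finite $F\subseteq X$ and all but finitely many $\mathcal{F}\in\mathcal{P}$, $F$ is contained in some member of $\mathcal{F}$. $[\mathbb{N}]^{\aleph_0}$ is the family of infinite subsets of $\mathbb{N}$, viewed as a subspace of $\mathcal{P}(\mathbb{N})$, which is identified with the product space $\{0,1\}^{\mathbb{N}}$ via characteristic functions. A continuous image of $X$ in $[\mathbb{N}]^{\aleph_0}$ is a set $\Psi[X]$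 with $\Psi:X\to[\mathbb{N}]^{\aleph_0}$ continuous. Filters on $\mathbb{N}$ are nonprincipal: a filter is a family of subsets of $\mathbb{N}$ that contains all cofinite sets, does not contain $\emptyset$, and is closed under supersets and finite intersections. A family $\mathcal{B}$ is a subbase for a filter $\mathcal{F}$ if $\mathcal{B}\subseteq\mathcal{F}$ and each element of $\mathcal{F}$ contains the intersection of some nonempty finite subfamily of $\mathcal{B}$. A filter $\mathcal{F}$ on $\mathbb{N}$ is feeble if there is an increasing $h\in\mathbb{N}^{\mathbb{N}}$ such that each $a\in\mathcal{F}$ intersects all but finitely many of the sets $[h(n),h(n+1))$, $n\in\mathbb{N}$; otherwise it is nonfeeble. *)

(* Defs.v *)
From mathcomp Require Import all_boot all_order all_algebra.
From mathcomp Require Import all_classical all_reals all_analysis.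

Set Implicit Arguments.
Unset Strict Implicit.
Unset Printing Implicit Defensive.

Import numFieldNormedType.Exports.

Local Open Scope classical_set_scope.

(* The library's [zero_dimensional] only asks that clopen sets separate points,
   which is not equivalent to having a clopen base. *)
Definition has_clopen_base (X : topologicalType) : Prop :=
  exists2 B : set (set X), basis B & forall U, B U -> clopen U.

(* The coercion of a set to a type carries the subspace topology; the ambient
   space [{ptws X -> R}] is the Tychonoff product. *)
Definition Cp (X : topologicalType) (R : realType) : topologicalType :=
  [set f : {ptws X -> R} | continuous (f : X -> R)].

Definition Reznichenko (Y : topologicalType) : Prop :=
  forall (A : set Y) (y : Y), closure A y -> ~ A y ->
    exists F : nat -> set Y,
      [/\ trivIset [set: nat] F,
          forall n, finite_set (F n) /\ F n `<=` A &
          forall N : set Y, nbhs y N -> \forall n \near \oo, N `&` F n !=set0].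

Definition omega_cover (X : Type) (U : set (set X)) : Prop :=
  ~ U [set: X] /\
  forall F : set X, finite_set F -> exists2 V, U V & F `<=` V.

Definition clopen_omega_cover (X : topologicalType) (U : set (set X)) : Prop :=
  omega_cover U /\ forall V, U V -> clopen V.

(* When [P] is finite the last condition is vacuous, so every finite cover is
   groupable; [partition] makes the pieces nonempty. *)
Definition omega_groupable_cover (X : Type) (U : set (set X)) : Prop :=
  cover U id = [set: X] /\
  exists P : set (set (set X)),
    [/\ partition P id U,
        forall G, P G -> finite_set G &
        forall F : set X, finite_set F ->
          finite_set [set G | P G /\ ~ exists2 V, G V & F `<=` V]].

Definition subset_of_char (c : cantor_space) : set nat := [set n | c n].

(* The infinite subsets of nat, as a subspace of the Cantor space. *)
Definition infinite_subsets : topologicalType :=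
  [set c : cantor_space | infinite_set (subset_of_char c)].

(* The image of [Psi], read as a family of subsets of nat. *)
Definition image_family (X : Type) (Psi : X -> infinite_subsets) :
    set (set nat) :=
  [set subset_of_char (set_val (Psi x)) | x in [set: X]].

Definition nonprincipal_filter (F : set (set nat)) : Prop :=
  ProperFilter F /\ forall a : set nat, finite_set (~` a) -> F a.

Definition subbase_for (B F : set (set nat)) : Prop :=
  B `<=` F /\
  forall a, F a -> exists C : set (set nat),
    [/\ C `<=` B, finite_set C, C !=set0 & \bigcap_(b in C) b `<=` a].

(* [h] is strictly increasing, so that the intervals are nonempty. *)
Definition feeble (F : set (set nat)) : Prop :=
  exists h : nat -> nat,
    {homo h : m n / (m < n)%N} /\
    forall a, F a ->
      \forall n \near \oo, a `&` [set k | (h n <= k < h n.+1)%N] !=set0.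

(* Main.v *)
(** The implications are (1) => (3) => (2) => (1).  Throughout, the condition
    on filters in (2) is used as a statement on sequences: if [V_j] are clopen
    and every finite subset of [X] is contained in [V_j] for arbitrarily large
    [j], then [nat] splits into intervals almost all of which contain such
    a [j].  Indeed [x |-> {j | x \in V_j}] is a continuous image of [X] which
    generates a nonprincipal filter as soon as no [V_j] is [X].

    (1) => (3): apply the Reznichenko property to the indicator functions of
    the complements of the members of the cover.

    (3) => (2): if every clopen cover has a finite subcover, then (3) is
    vacuous but every clopen omega-cover has, for each [k], a finite subfamily
    catching all [k]-tuples, which gives (2).  Otherwise (3) provides
    an exhaustion [W_n] of [X] by clopen proper subsets, and intersecting
    the members of a cover with the [W_n] makes the pieces of its groupable
    subcovers infinitely many.

    (2) => (1): clopen sets [C] with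
    [{|f - y| < 1/(m+2)} `<=` C `<=` {|f - y| < 1/(m+1)}] exist because
    [X] is zero-dimensional and Lindeloef with respect to clopen covers.  They
    reduce [A] to a countable subset [f_j], then yield for each [m]
    a partition of [nat] into intervals, and these partitions are diagonalised
    into one that serves all [m]. *)
Require Import Defs.
From mathcomp Require Import all_boot all_order all_algebra.
From mathcomp Require Import all_classical all_reals all_analysis.

Import Order.TTheory GRing.Theory Num.Theory.
Import numFieldNormedType.Exports.

Local Open Scope classical_set_scope.

(** * Enumerations and interval partitions of the natural numbers *)

Lemma infinite_set_inj {T : Type} {A : set T} : infinite_set A ->
  exists2 g : nat -> T, injective g & forall n, A (g n).
Proof.
move=> /infiniteP /card_leP[f]; exists (fun n => val (f (to_setT n))).
  by move=> m n /val_inj /inj; rewrite !inE => /(_ I I) /(congr1 val).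
by move=> n; exact: set_valP.
Qed.

Lemma countable_infinite_enum {T : Type} {A : set T} : countable A ->
  infinite_set A -> exists2 g : nat -> T, injective g & range g = A.
Proof.
move=> cA iA; have := eq_card_nat cA iA.
rewrite card_eq_sym => /card_eqP[f]; exists (fun n => val (f (to_setT n))).
  by move=> m n /val_inj /inj; rewrite !inE => /(_ I I) /(congr1 val).
rewrite eqEsubset; split=> [_ [n _ <-]|x Ax]; first exact: set_valP.
have [n _ fn] := surj (f := f) (t := SigSub (mem_set Ax)) I.
exists (val n) => //; rewrite (_ : to_setT (val n) = n) ?fn //.
exact: val_inj.
Qed.

(** [P n p q] reads: the interval from [p] to [q] may serve as block number [n]. Iterating a choice
    of right ends from 0 gives the partition. *)
Lemma homo_seq (P : nat -> nat -> nat -> Prop) :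
  (forall n p, exists q, (p < q)%N /\ P n p q) ->
  exists h : nat -> nat,
    {homo h : m n / (m < n)%N} /\ forall n, P n (h n) (h n.+1).
Proof.
move=> Pex; have [q qP] := choice (fun np : nat * nat => Pex np.1 np.2).
pose h := fix h n := if n is n'.+1 then q (n', h n') else 0.
exists h; split => [|n]; last by case: (qP (n, h n)).
by apply: homo_ltn => [? ? ?|n]; [exact: ltn_trans|case: (qP (n, h n))].
Qed.

Lemma homo_ltn_leq {h : nat -> nat} : {homo h : m n / (m < n)%N} ->
  forall n, (n <= h n)%N.
Proof. by move=> h_homo; elim=> // n /leq_ltn_trans; apply; exact: h_homo. Qed.

Lemma finite_nat_ubound {A : set nat} : finite_set A ->
  exists q, forall j, A j -> (j < q)%N.
Proof.
move=> /finite_seqP[s ->]; exists (\max_(j <- s) j).+1 => j /= js.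
by rewrite ltnS (big_rem j js) /= leq_maxl.
Qed.

(** By disjointness at most one [H k] contains a given number, so each step of the induction on [p]
    has at most one further index to avoid. *)
Lemma trivIset_escape {H : nat -> set nat} (p : nat) :
  trivIset [set: nat] H ->
  exists K, forall k, (K <= k)%N -> forall j, H k j -> (p <= j)%N.
Proof.
move=> Htriv; elim: p => [|p [K KP]]; first by exists 0.
have [[k0 Hk0]|nk] := pselect (exists k, H k p).
  exists (maxn K k0.+1) => k; rewrite geq_max => /andP[Kk k0k] j Hkj.
  rewrite ltn_neqAle (KP k) // andbT; apply: contraTneq k0k => pj.
  have -> : k0 = k by apply: Htriv => //; exists j; split; rewrite -?pj // pj.
  by rewrite -leqNgt.
exists K => k Kk j Hkj; rewrite ltn_neqAle (KP k) // andbT.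
by apply/eqP => pj; apply: nk; exists k; rewrite pj.
Qed.

Lemma trivIset_interval (H : nat -> set nat) :
  trivIset [set: nat] H -> (forall n, finite_set (H n)) ->
  exists h : nat -> nat, {homo h : m n / (m < n)%N} /\
    forall n, exists2 k, (n <= k)%N &
      H k `<=` [set j | (h n <= j < h n.+1)%N].
Proof.
move=> Htriv Hfin.
apply: (@homo_seq (fun n p q =>
  exists2 k, (n <= k)%N & H k `<=` [set j | (p <= j < q)%N])) => n p.
have [K KP] := trivIset_escape p Htriv.
have [q qP] := finite_nat_ubound (Hfin (maxn K n)).
exists (maxn p.+1 q); split; first by rewrite leq_max leqnn.
exists (maxn K n); first by rewrite leq_maxr.
move=> j Hj /=; rewrite (KP _ (leq_maxl _ _) _ Hj) /=.
by rewrite leq_max (qP _ Hj) orbT.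
Qed.

(** * Families that eventually catch each finite set *)

Definition eventually_hits {T : Type} (G : nat -> set (set T)) : Prop :=
  forall F : set T, finite_set F ->
    \forall n \near \oo, exists2 V, G n V & F `<=` V.

Definition blocks {T : Type} (V : nat -> set T) (h : nat -> nat) (n : nat) :
  set (set T) := V @` [set j | (h n <= j < h n.+1)%N].

(** Choosing one index for each member of [range W] turns the groups into disjoint finite sets of
    numbers. An interval containing such a set gives a block whose members include supersets of
    those of the group. *)
Lemma groups_blocks {T : Type} (W V : nat -> set T) (G : nat -> set (set T)) :
  (forall j, W j `<=` V j) -> trivIset [set: nat] G ->
  (forall n, finite_set (G n)) -> (forall n, G n `<=` range W) ->
  eventually_hits G ->
  exists h, {homo h : m n / (m < n)%N} /\ eventually_hits (blocks V h).
Proof.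
move=> WV Gtriv Gfin GW Ghit.
have /choice[idx idxP] : forall E, exists j, range W E -> W j = E.
  by move=> E; have [[j _ <-]|nE] := pselect (range W E); [exists j|exists 0].
have [|n|h [h_homo hP]] := @trivIset_interval (fun n => idx @` G n).
- move=> m n _ _ [j [[E GE <-] [E' GE' EE']]]; apply: Gtriv => //.
  exists E; split => //; rewrite -(idxP E (GW _ _ GE)) -EE' idxP //.
  exact: GW GE'.
- exact: finite_image.
exists h; split => // F /Ghit[N _ NP]; exists N => // n /= Nn.
have [k nk kP] := hP n.
have [E GE FE] := NP _ (leq_trans Nn nk).
exists (V (idx E)); first by exists (idx E) => //; apply: kP; exists E.
by apply: subset_trans (WV _); rewrite (idxP _ (GW _ _ GE)).
Qed.

Definition countable_omega_subcovers (X : topologicalType) : Prop :=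
  forall U : set (set X), clopen_omega_cover U ->
    exists V : set (set X), [/\ V `<=` U, countable V & omega_cover V].

Definition nonfeeble_subbase_image (X : topologicalType) : Prop :=
  exists (Psi : X -> infinite_subsets) (F : set (set nat)),
    [/\ continuous Psi, nonprincipal_filter F, ~ feeble F &
        subbase_for (image_family Psi) F].

Definition clopen_blocks (X : topologicalType) : Prop :=
  forall V : nat -> set X, (forall j, clopen (V j)) ->
    (forall (F : set X) p, finite_set F -> exists2 j, (p <= j)%N & F `<=` V j) ->
    exists h, {homo h : m n / (m < n)%N} /\ eventually_hits (blocks V h).

(** Here infinitely many groups are nonempty, which excludes the vacuous case of finite groupable
    covers. *)
Definition clopen_groups (X : topologicalType) : Prop :=
  forall U : set (set X), clopen_omega_cover U ->
    exists G : nat -> set (set X),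
      [/\ trivIset [set: nat] G, forall n, finite_set (G n),
          forall n, G n `<=` U & eventually_hits G].

Definition clopen_groupable (X : topologicalType) : Prop :=
  forall U : set (set X), clopen_omega_cover U ->
    exists V : set (set X), V `<=` U /\ omega_groupable_cover V.

(** * Clopen sequences and filters generated by continuous images *)

Lemma continuous_bool {X : topologicalType} (f : X -> bool) :
  clopen [set x | f x] -> continuous f.
Proof.
move=> [fo fc] x A /nbhs_singleton /= Afx.
have : nbhs x [set y | f y = f x].
  case fx : (f x); first exact: open_nbhs_nbhs.
  have := fc; rewrite -openC => fo'.
  rewrite (_ : [set y | f y = false] = ~` [set y | f y]).
    by apply: open_nbhs_nbhs; split => //=; rewrite fx.
  by apply/seteqP; split => y /=; case: (f y).
by apply: filterS => y /= fyx; rewrite /= fyx.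
Qed.

Section characteristic_map.
Context {X : topologicalType} {V : nat -> set X}.
Context (V_clopen : forall j, clopen (V j)).
Context (V_inf : forall (F : set X) p, finite_set F ->
  exists2 j, (p <= j)%N & F `<=` V j).

Let char_of (x : X) : cantor_space := fun j => `[< V j x >].

Let char_of_inf x : infinite_set (subset_of_char (char_of x)).
Proof.
move=> /finite_nat_ubound[q qP].
have [j qj Fj] := V_inf _ q (finite_set1 x).
have /qP : subset_of_char (char_of x) j by apply/asboolP; exact: Fj.
by rewrite ltnNge qj.
Qed.

Definition char_map (x : X) : infinite_subsets :=
  exist _ (char_of x) (mem_set (char_of_inf x)).

Lemma char_mapE x : subset_of_char (set_val (char_map x)) = [set j | V j x].
Proof. by apply/seteqP; split => j /= /asboolP. Qed.

Lemma char_map_continuous : continuous char_map.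
Proof.
apply: (@continuous_comp_initial _ _ _ set_val) => x.
apply/cvg_sup => j.
apply: (@continuous_comp_initial _ _ _ (fun c : cantor_space => c j) char_of).
apply: continuous_bool; rewrite (_ : [set y | _] = V j) //.
by apply/seteqP; split => y /asboolP.
Qed.
End characteristic_map.

(** The sets [S F], for finite [F], are a base of the filter generated by the image of [char_map],
    and a witness of its feebleness is exactly the required [h]. *)
Lemma clopen_blocks_proper {X : topologicalType} (V : nat -> set X) :
  ~ nonfeeble_subbase_image X -> (forall j, clopen (V j)) ->
  (forall j, V j != [set: X]) ->
  (forall (F : set X) p, finite_set F -> exists2 j, (p <= j)%N & F `<=` V j) ->
  exists h, {homo h : m n / (m < n)%N} /\ eventually_hits (blocks V h).
Proof.
move=> Nnf V_clopen V_proper V_inf.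
pose S (F : set X) := [set j | F `<=` V j].
pose FF : set (set nat) :=
  [set a | exists2 F : set X, finite_set F & S F `<=` a].
have SI F F' : S F `&` S F' = S (F `|` F').
  by apply/seteqP; split => j /=; rewrite /S /= subUset.
have /choice[out outP] : forall j, exists x, ~ V j x.
  move=> j; apply/existsNP => Vj; move/eqP: (V_proper j); apply.
  by apply/seteqP; split.
apply: contrapT => noh; apply: Nnf.
exists (char_map V_inf), FF; split.
- exact: char_map_continuous.
- split.
    split.
      move=> [F Ffin SF]; have [j _ Fj] := V_inf F 0 Ffin.
      exact: (SF j).
    split.
    + by exists set0 => //; exact: finite_set0.
    + move=> a b [F Ffin Fa] [F' F'fin F'b]; exists (F `|` F').
        by rewrite finite_setU.
      by rewrite -SI; exact: setISS.
    + by move=> a b ab [F Ffin Fa]; exists F => //; exact: subset_trans ab.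
  (* One point outside [V j] is taken for each of the finitely many [j] missing from [a], so a [V j]
     containing all these points has [j] in [a]. *)
  move=> a afin; exists (out @` (~` a)); first exact: finite_image.
  move=> j Sj; apply: contrapT => aj; apply: (outP j); apply: Sj.
  by exists j.
- move=> [h [h_homo hP]]; apply: noh; exists h; split => // F Ffin.
  have [|N _ NP] := hP (S F); first by exists F.
  exists N => // n /NP[j [Fj hj]]; exists (V j) => //.
  by exists j.
- split => [_ [x _ <-]|a [F Ffin Fa]].
    rewrite char_mapE; exists [set x]; first exact: finite_set1.
    by move=> j /= Vx; apply: Vx.
  (* The extra point [out 0] keeps the subfamily nonempty when [F] is empty. *)
  exists [set subset_of_char (set_val (char_map V_inf x)) |
    x in F `|` [set out 0]].
  split.
  + by move=> _ [x _ <-]; exists x.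
  + by apply: finite_image; rewrite finite_setU; split=> //; exact: finite_set1.
  + by eexists; exists (out 0) => //; right.
  + apply: subset_trans Fa => j jP x Fx.
    have : [set j | V j x] j.
      by rewrite -(char_mapE V_inf); apply: jP; exists x => //; left.
    by [].
Qed.

(** Either the [V j] are proper from some [p0] on, and a shift reduces to the proper case, or [V j]
    is the whole space for arbitrarily large [j], and each block is made to contain such a [j]. *)
Lemma clopen_blocksP {X : topologicalType} :
  ~ nonfeeble_subbase_image X -> clopen_blocks X.
Proof.
move=> Nnf V V_clopen V_inf.
have [[p0 p0P]|full] :=
    pselect (exists p, forall j, (p <= j)%N -> V j != [set: X]).
  have [|//|F p Ffin|h [h_homo hP]] :=
      @clopen_blocks_proper X (fun j => V (p0 + j)%N) Nnf.
  - by move=> j; exact: V_clopen.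
  - by move=> j; apply: p0P; exact: leq_addr.
  - have [j pj Fj] := V_inf F (p0 + p)%N Ffin.
    have p0j : (p0 <= j)%N by rewrite (leq_trans _ pj)// leq_addr.
    by exists (j - p0)%N; rewrite ?subnKC// leq_subRL.
  exists (fun n => p0 + h n)%N; split => [m n mn|F /hP[N _ NP]].
    by rewrite ltn_add2l h_homo.
  exists N => // n /NP[_ [j /andP[hj jh] <-] Fj].
  exists (V (p0 + j)%N) => //; exists (p0 + j)%N => //=.
  by rewrite leq_add2l ltn_add2l hj.
have [|h [h_homo hP]] := @homo_seq (fun _ p q =>
    exists2 j, (p <= j < q)%N & V j = [set: X]).
  move=> _ p; have [j /not_implyP[pj /negP/negPn/eqP Vj]] :
      exists j, ~ ((p <= j)%N -> V j != [set: X]).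
    by apply/existsNP => pP; apply: full; exists p.
  by exists j.+1; split; rewrite ?ltnS//; exists j => //; rewrite pj /=.
exists h; split => // F _; exists 0 => // n _; have [j jn Vj] := hP n.
by exists (V j); [exists j|rewrite Vj].
Qed.

(** For [V j] the set of points whose image contains [j], the [j] with [F] inside [V j] form a
    finite intersection of images. It belongs to the filter, hence is unbounded by
    nonprincipality. *)
Lemma clopen_blocks_feeble {X : topologicalType} :
  clopen_blocks X -> ~ nonfeeble_subbase_image X.
Proof.
move=> blocksX [Psi [FF [Psi_cont [FF_proper FF_cof] FF_nf [subF FsubF]]]].
apply: FF_nf.
pose V j := [set x | set_val (Psi x) j].
have capF (F : set X) : finite_set F -> FF [set j | F `<=` V j].
  move=> Ffin.
  suff : FF (\bigcap_(x in F) subset_of_char (set_val (Psi x))) by [].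
  move/finite_fsetP: Ffin => [D ->].
  by apply: filter_bigI => x _; apply: subF; exists x.
have [|F p Ffin|h [h_homo hP]] := blocksX V.
- move=> j; rewrite (_ : V j = (fun x => set_val (Psi x) j) @^-1` [set true]).
    apply: preimage_clopen; first split.
    - exact: discrete_open.
    - exact: discrete_closed.
    move=> x; apply: (@continuous_comp _ _ _ Psi
      (fun c : infinite_subsets => set_val c j)).
      exact: Psi_cont.
    apply: (@continuous_comp _ _ _
      (set_val : infinite_subsets -> cantor_space) (fun c => c j)).
      exact: initial_continuous.
    exact: (@proj_continuous nat (fun _ => bool) j).
  by apply/seteqP; split.
- have cofp : FF [set j | (p <= j)%N].
    apply: FF_cof; apply: (sub_finite_set _ (finite_II p)) => j /= /negP.
    by rewrite -ltnNge.
  have [j [pj Fj]] := filter_ex (filterI cofp (capF _ Ffin)).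
  by exists j.
exists h; split => // a /FsubF[C [CF Cfin [b0 Cb0] Ca]].
(* The finite subfamily [C] is lifted to finitely many points; [b0] supplies the default point of
   the choice. *)
have [F [Ffin FC]] : exists F : set X, finite_set F /\
    C `<=` [set subset_of_char (set_val (Psi x)) | x in F].
  have /choice[g gP] : forall b, exists x,
      C b -> subset_of_char (set_val (Psi x)) = b.
    move=> b; have [/CF[x _ <-]|nCb] := pselect (C b); first by exists x.
    by have [x _ _] := CF _ Cb0; exists x.
  exists (g @` C); split; first exact: finite_image.
  by move=> b Cb; exists (g b); [exists b|exact: gP].
have [N _ NP] := hP F Ffin.
exists N => // n /NP[_ [j hj <-] Fj]; exists j; split => //.
apply: Ca => b /FC[x Fx <-]; exact: Fj.
Qed.

(** * Groupable covers as sequences of disjoint finite groups *)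

Lemma groups_groupable {X : topologicalType} :
  clopen_groups X -> clopen_groupable X.
Proof.
move=> groupsX U /groupsX[G [Gtriv Gfin GU Ghit]].
exists (\bigcup_n G n); split; first by move=> V [n _ /GU].
split.
  apply/seteqP; split => // x _.
  have [N _ NP] := Ghit _ (finite_set1 x).
  have [V GV xV] := NP N (leqnn N).
  by exists V; [exists N|exact: xV].
exists [set E | (exists n, E = G n) /\ E !=set0]; split.
- split.
  + apply/seteqP; split => [V [_ [[n ->] _] GV]|V [n _ GV]]; first by exists n.
    by exists (G n) => //; split; [exists n|exists V].
  + by move=> _ _ [[m ->] _] [[n ->] _] mn; rewrite (Gtriv m n).
  + by move=> E [].
- by move=> _ [[n ->] _].
- move=> F /Ghit[N _ NP].
  apply: (sub_finite_set _ (finite_image G (finite_II N))).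
  move=> _ [[[n ->] _] nhit]; exists n => //=; rewrite ltnNge; apply/negP => Nn.
  exact/nhit/NP.
Qed.

Definition no_finite_subcover {X : Type} (U : set (set X)) : Prop :=
  forall D, finite_set D -> D `<=` U -> cover D id <> [set: X].

(** Finitely many finite pieces would make [U] a finite cover. So there are infinitely many, and any
    injective sequence of pieces works: those that fail to catch [F] have bounded indices. *)
Lemma omega_groupable_groups {X : Type} {U : set (set X)} :
  omega_groupable_cover U ->
  no_finite_subcover U ->
  exists G : nat -> set (set X),
    [/\ trivIset [set: nat] G, forall n, finite_set (G n),
        forall n, G n `<=` U & eventually_hits G].
Proof.
move=> [coverU [P [[UP Ptriv _] Pfin Phit]]] nofin.
have /infinite_set_inj[G Ginj PG] : infinite_set P.
  move=> P_fin; apply: (nofin U) => //; rewrite -UP.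
  exact: bigcup_finite.
exists G; split.
- by move=> m n _ _ mn; apply: Ginj; exact: Ptriv.
- by move=> n; exact: Pfin.
- by move=> n V GV; rewrite -UP; exists (G n).
move=> F /Phit bad.
have [|q qP] := @finite_nat_ubound
    [set n | P (G n) /\ ~ exists2 V, G n V & F `<=` V].
  apply: finite_preimage bad => m n _ _; exact: Ginj.
exists q => // n /= qn; apply: contrapT => nhit.
by have := qP n (conj (PG n) nhit); rewrite ltnNge qn.
Qed.

(** * The case where clopen covers have finite subcovers *)

Definition finite_clopen_subcovers (X : topologicalType) : Prop :=
  forall U : set (set X), (forall V, U V -> clopen V) ->
    cover U id = [set: X] ->
    exists D, [/\ finite_set D, D `<=` U & cover D id = [set: X]].

Lemma clopen_bigcup {X : topologicalType} {I : choiceType} (D : set I)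
    (F : I -> set X) :
  finite_set D -> (forall i, D i -> clopen (F i)) ->
  clopen (\bigcup_(i in D) F i).
Proof.
move=> Dfin Fclopen; split; first by apply: bigcup_open => i /Fclopen[].
by apply: closed_bigcup => // i /Fclopen[].
Qed.

Lemma clopen_bigcap {X : topologicalType} {I : choiceType} (D : set I)
    (F : I -> set X) :
  finite_set D -> (forall i, D i -> clopen (F i)) ->
  clopen (\bigcap_(i in D) F i).
Proof.
move=> Dfin Fclopen; rewrite -[X in clopen X]setCK setC_bigcap.
apply: clopenC; first exact: set0.
by apply: clopen_bigcup => // i /Fclopen; apply: clopenC; exact: set0.
Qed.

(* Induction on [k]: the members containing the first point [x] of a tuple
   cover the [k]-tuples; finitely many of them do, and their intersection is
   a clopen neighbourhood of [x] that serves all its points. *)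
Lemma finite_tuple_subcover {X : topologicalType} (k : nat) (U : set (set X)) :
  finite_clopen_subcovers X -> (forall V, U V -> clopen V) ->
  (forall s : seq X, (size s <= k)%N -> exists2 V, U V & [set` s] `<=` V) ->
  exists D, [/\ finite_set D, D `<=` U &
    forall s : seq X, (size s <= k)%N -> exists2 V, D V & [set` s] `<=` V].
Proof.
move=> finX; elim: k U => [|k IHk] U Uclopen Ucov.
  have [V UV _] := Ucov [::] isT; exists [set V]; split.
  - exact: finite_set1.
  - by move=> _ ->.
  - by move=> [|//] _; exists V => // x.
have /choice[D_ D_P] : forall x, exists D, [/\ finite_set D,
    D `<=` [set V | U V /\ V x] & forall s : seq X, (size s <= k)%N ->
      exists2 V, D V & [set` s] `<=` V].
  move=> x; apply: IHk => [V [/Uclopen]//|s sk].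
  have [V UV sV] := Ucov (x :: s) sk.
  exists V; first by split => //; apply: sV; rewrite /= mem_head.
  by move=> y ys; apply: sV; rewrite /= in_cons ys orbT.
have [||E [Efin ED coverE]] := finX [set \bigcap_(V in D_ x) V | x in [set: X]].
- move=> _ [x _ <-]; have [Dfin DU _] := D_P x.
  by apply: clopen_bigcap => // V /DU[/Uclopen].
- apply/seteqP; split => // x _; exists (\bigcap_(V in D_ x) V); first by exists x.
  by have [_ DU _] := D_P x => V /DU[].
have /choice[g gP] : forall W, exists D, [/\ finite_set D, D `<=` U & E W ->
    D `<=` [set V | W `<=` V] /\ forall s : seq X, (size s <= k)%N ->
      exists2 V, D V & [set` s] `<=` V].
  move=> W; have [/ED[x _ <-]|nEW] := pselect (E W); last by exists set0; split.
  have [Dfin DU sD] := D_P x; exists (D_ x); split => //.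
    by move=> V /DU[].
  by move=> _; split => // V DV y; apply.
(* The empty tuple has no first point, so a member [V0] is added for it. *)
have [V0 UV0 _] := Ucov [::] isT.
exists (V0 |` \bigcup_(W in E) g W); split.
- rewrite finite_setU; split; first exact: finite_set1.
  by apply: bigcup_finite => // W _; have [] := gP W.
- by move=> V [->//|[W _]]; have [_ DU _] := gP W => /DU.
move=> [_|x s sk]; first by exists V0; [left|].
have [W EW Wx] : cover E id x by rewrite coverE.
have [_ _ /(_ EW)[WV /(_ s sk)[V DV sV]]] := gP W.
exists V; first by right; exists W.
move=> y /=; rewrite in_cons => /orP[/eqP ->|/sV//].
exact: WV Wx.
Qed.

Lemma finite_subcovers_countable_omega {X : topologicalType} :
  finite_clopen_subcovers X -> countable_omega_subcovers X.
Proof.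
move=> finX U [[UT Ucov] Uclopen].
have /choice[D DP] k : exists D, [/\ finite_set D, D `<=` U &
    forall s : seq X, (size s <= k)%N -> exists2 V, D V & [set` s] `<=` V].
  by apply: finite_tuple_subcover => // s _; apply: Ucov; exact: finite_seq.
exists (\bigcup_k D k); split.
- by move=> V [k _]; have [_ DU _] := DP k => /DU.
- apply: bigcup_countable => // k _; apply: finite_set_countable.
  by have [] := DP k.
split; first by move=> [k _]; have [_ DU _] := DP k => /DU.
move=> F /finite_seqP[s ->]; have [_ _ /(_ s (leqnn _))[V DV sV]] := DP (size s).
by exists V => //; exists (size s).
Qed.

(** Block [n] is made long enough to catch all tuples of length at most [n]. *)
Lemma finite_subcovers_clopen_blocks {X : topologicalType} :
  finite_clopen_subcovers X -> clopen_blocks X.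
Proof.
move=> finX V V_clopen V_inf.
have [|h [h_homo hP]] := @homo_seq (fun n p q => forall s : seq X,
    (size s <= n)%N -> exists2 j, (p <= j < q)%N & [set` s] `<=` V j).
  move=> n p.
  have [|s sn|D [Dfin DV Dhit]] := @finite_tuple_subcover X n
      (V @` [set j | (p <= j)%N]) finX.
  - by move=> _ [j _ <-].
  - have [j pj sj] := V_inf _ p (finite_seq s).
    by exists (V j) => //; exists j.
  have /choice[idx idxP] : forall E, exists j, D E -> (p <= j)%N /\ V j = E.
    move=> E; have [/DV[j pj <-]|nDE] := pselect (D E); first by exists j.
    by exists 0.
  have [q qP] := finite_nat_ubound (finite_image idx Dfin).
  exists (maxn p.+1 q); split; first by rewrite leq_max leqnn.
  move=> s /Dhit[E DE sE]; have [pj VE] := idxP E DE.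
  exists (idx E); last by rewrite VE.
  by rewrite pj leq_max qP ?orbT//; exists E.
exists h; split => // F /finite_seqP[s ->]; exists (size s) => // n /= sn.
by have [j hj sj] := hP n s sn; exists (V j) => //; exists j.
Qed.

(** * From (3) to (2) by clopen exhaustions *)

Section no_finite_subcover.
Context {X : topologicalType}.
Context (groupableX : clopen_groupable X).

Lemma sub_no_finite_subcover {U V : set (set X)} : V `<=` U ->
  no_finite_subcover U -> no_finite_subcover V.
Proof. by move=> VU nfU D Dfin DV; apply: nfU => //; exact: subset_trans VU. Qed.

Lemma no_finite_subcover_groups {U : set (set X)} : clopen_omega_cover U ->
  no_finite_subcover U ->
  exists G : nat -> set (set X),
    [/\ trivIset [set: nat] G, forall n, finite_set (G n),
        forall n, G n `<=` U & eventually_hits G].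
Proof.
move=> /groupableX[V [VU /omega_groupable_groups Vgroups]] nfU.
have [G [Gtriv Gfin GV Ghit]] := Vgroups (sub_no_finite_subcover VU nfU).
by exists G; split => // n; exact: subset_trans VU.
Qed.

(** The finite unions of a clopen cover without finite subcover form an omega-cover [UF] that still
    has no finite subcover. [W n] is the union of all members of the groups 0 to [n] obtained for
    [UF]; it is proper because these members are finitely many. *)
Lemma clopen_exhaustion : ~ finite_clopen_subcovers X ->
  exists W : nat -> set X, [/\ forall n, clopen (W n),
    forall n, W n <> [set: X], {homo W : m n / (m <= n)%N >-> m `<=` n} &
    forall F, finite_set F -> \forall n \near \oo, F `<=` W n].
Proof.
move=> /existsNP[U /not_implyP[Uclopen /not_implyP[Ucover nfin]]].
pose UF : set (set X) :=
  [set cover D id | D in [set D | finite_set D /\ D `<=` U]].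
have nfUF : no_finite_subcover UF.
  move=> E Efin EUF coverE; apply: nfin.
  have /choice[g gP] : forall W, exists D, [/\ finite_set D, D `<=` U &
      E W -> W `<=` cover D id].
    move=> W; have [/EUF[D [Dfin DU] <-]|nEW] := pselect (E W).
      by exists D; split => // _.
    by exists set0; split.
  exists (\bigcup_(W in E) g W); split.
  - by apply: bigcup_finite => // W _; have [] := gP W.
  - by move=> V [W _]; have [_ gU _] := gP W => /gU.
  apply/seteqP; split => // x _.
  have [W EW Wx] : cover E id x by rewrite coverE.
  have [_ _ /(_ EW x Wx)[V gV Vx]] := gP W.
  by exists V => //; exists W.
have UFclopen V : UF V -> clopen V.
  by move=> [D [Dfin DU] <-]; apply: clopen_bigcup => // W /DU/Uclopen.
have UFomega : clopen_omega_cover UF.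
  split => //; split.
    move=> UFT; apply: (nfUF [set setT]); first exact: finite_set1.
      by move=> _ ->.
    by apply/seteqP; split => // x _; exists setT.
  move=> F Ffin; have /choice[g gP] : forall x, exists V, U V /\ V x.
    move=> x; have [V UV Vx] : cover U id x by rewrite Ucover.
    by exists V.
  exists (cover (g @` F) id).
    exists (g @` F) => //; split; first exact: finite_image.
    by move=> _ [x _ <-]; have [] := gP x.
  by move=> x Fx; exists (g x); [exists x|have [] := gP x].
have [G [_ Gfin GU Ghit]] := no_finite_subcover_groups UFomega nfUF.
pose D n := \bigcup_(i in `I_n.+1) G i.
have Dfin n : finite_set (D n) by apply: bigcup_finite => //; exact: finite_II.
have DU n : D n `<=` UF by move=> V [i _ /GU].
exists (fun n => cover (D n) id); split.
- by move=> n; apply: clopen_bigcup => // V /DU/UFclopen.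
- by move=> n; exact: nfUF.
- move=> m n mn x [V [i im GV] Vx]; exists V => //; exists i => //=.
  exact: leq_trans mn.
- move=> F /Ghit[N _ NP]; exists N => // n /NP[V GV FV] x Fx.
  by exists V; [exists n => /=|exact: FV].
Qed.

(** As [W] increases, finitely many members of [U] lie in a single [W q], which is proper. *)
Lemma no_finite_subcover_sub (W : nat -> set X) (U : set (set X)) :
  (forall n, W n <> [set: X]) -> {homo W : m n / (m <= n)%N >-> m `<=` n} ->
  (forall V, U V -> exists n, V `<=` W n) -> no_finite_subcover U.
Proof.
move=> WT W_homo UW D Dfin DU coverD.
have /choice[idx idxP] : forall V, exists n, D V -> V `<=` W n.
  move=> V; have [/DU/UW[n VW]|nDV] := pselect (D V); first by exists n.
  by exists 0.
have [q qP] := finite_nat_ubound (finite_image idx Dfin).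
apply: (WT q); apply/seteqP; split => // x _.
have [V DV Vx] : cover D id x by rewrite coverD.
apply: (W_homo (idx V)); last exact: idxP.
by apply/ltnW/qP; exists V.
Qed.

(** Groups are found among the traces of members of [U] on the [W n]; choosing a member of [U] above
    each trace that occurs leads back to [U]. *)
Lemma groupable_countable_omega : countable_omega_subcovers X.
Proof.
have [finX|/clopen_exhaustion[W [Wclopen WT W_homo W_near]]] :=
    pselect (finite_clopen_subcovers X).
  exact: finite_subcovers_countable_omega.
move=> U [[UT Ucov] Uclopen].
pose UW := [set E | exists V n, U V /\ E = V `&` W n].
have nfUW : no_finite_subcover UW.
  by apply: no_finite_subcover_sub WT W_homo _ => _ [V [n [_ ->]]]; exists n.
have [|G [_ Gfin GUW Ghit]] := @no_finite_subcover_groups UW _ nfUW.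
  split; last by move=> _ [V [n [/Uclopen Vclopen ->]]]; exact: clopenI.
  split.
    move=> [V [n [_ TVW]]]; apply: (WT n); apply/seteqP; split => //.
    by rewrite TVW.
  move=> F Ffin; have [V UV FV] := Ucov F Ffin.
  have [N _ /(_ N (leqnn N)) FW] := W_near F Ffin.
  by exists (V `&` W N); [exists V, N|rewrite subsetI].
have /choice[g gP] : forall E, exists V, UW E -> U V /\ E `<=` V.
  move=> E; have [[V [n [UV ->]]]|nE] := pselect (UW E); last by exists set0.
  by exists V => _; split => // x [].
exists (g @` \bigcup_n G n); split.
- by move=> _ [E [n _ /GUW/gP[gU _]] <-].
- apply: (sub_countable (card_image_le _ _)); apply: bigcup_countable => // n _.
  exact: finite_set_countable.
split; first by move=> [E [n _ /GUW/gP[gU _]] gT]; apply: UT; rewrite -gT.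
move=> F /Ghit[N _ /(_ N (leqnn N))[E GE FE]]; exists (g E).
  by exists E => //; exists N.
by have [_] := gP E (GUW _ _ GE); exact: subset_trans.
Qed.

Lemma groupable_clopen_blocks : clopen_blocks X.
Proof.
have [finX|/clopen_exhaustion[W [Wclopen WT W_homo W_near]]] :=
    pselect (finite_clopen_subcovers X).
  exact: finite_subcovers_clopen_blocks.
move=> V V_clopen V_inf.
have nf : no_finite_subcover (range (fun j => V j `&` W j)).
  by apply: no_finite_subcover_sub WT W_homo _ => _ [n _ <-]; exists n.
have [|G [Gtriv Gfin GW Ghit]] := no_finite_subcover_groups _ nf.
  split; last by move=> _ [n _ <-]; exact: clopenI.
  split.
    by move=> [n _ VWT]; apply: (WT n); apply/seteqP; split; rewrite // -VWT.
  move=> F Ffin; have [N _ NP] := W_near F Ffin.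
  (* An index past [N] puts [F] inside [W j] as well as [V j]. *)
  have [j Nj Fj] := V_inf F N Ffin.
  by exists (V j `&` W j); [exists j|rewrite subsetI; split => //; exact: NP].
by apply: groups_blocks Gtriv Gfin GW Ghit => j x [].
Qed.

End no_finite_subcover.

(** * Separation by clopen sets *)

Lemma clopen_nbhs {X : topologicalType} : has_clopen_base X ->
  forall (O : set X) x, open O -> O x ->
    exists C, [/\ clopen C, C x & C `<=` O].
Proof.
move=> [B [_ Bbase] Bclopen] O x Oopen Ox.
have [C [BC Cx] CO] := Bbase x O (open_nbhs_nbhs (conj Oopen Ox)).
by exists C; split => //; exact: Bclopen.
Qed.

(** Unions of a clopen part of [O1] and a clopen part of [O2] contain all finite sets, so countably
    many of them cover the space. They are made disjoint by [seqDU], and on each resulting piece [C]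
    keeps the part inside [O1]. *)
Lemma clopen_separation {X : topologicalType} : has_clopen_base X ->
  countable_omega_subcovers X ->
  forall O1 O2 : set X, open O1 -> open O2 -> O1 `|` O2 = [set: X] ->
    exists C, [/\ clopen C, C `<=` O1 & ~` C `<=` O2].
Proof.
move=> baseX countX O1 O2 O1open O2open O12.
pose U : set (set X) := [set E | exists C1 C2, [/\ clopen C1, clopen C2,
  C1 `<=` O1, C2 `<=` O2 & E = C1 `|` C2]].
(* An omega-cover may not contain the whole space; if some union is the whole space, its first part
   already separates. *)
have [[C1 [C2 [C1clopen _ C1O C2O C12]]]|UT] := pselect (U setT).
  exists C1; split => // x nC1x; apply: C2O.
  by have [] : (C1 `|` C2) x by rewrite -C12.
have Uclopen E : U E -> clopen E.
  by move=> [C1 [C2 [C1clopen C2clopen _ _ ->]]]; exact: clopenU.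
have [|V [VU Vcount [_ Vcov]]] := countX U.
  split => //; split => // F Ffin.
  have /choice[g gP] : forall x, exists E : set X * set X,
      [/\ clopen E.1, clopen E.2, E.1 `<=` O1, E.2 `<=` O2 & (E.1 `|` E.2) x].
    move=> x; have [x1|x2] : (O1 `|` O2) x by rewrite O12.
      have [C [Cclopen Cx CO]] := clopen_nbhs baseX _ _ O1open x1.
      by exists (C, set0); split => //=; [exact: clopen0|left].
    have [C [Cclopen Cx CO]] := clopen_nbhs baseX _ _ O2open x2.
    by exists (set0, C); split => //=; [exact: clopen0|right].
  exists ((\bigcup_(x in F) (g x).1) `|` (\bigcup_(x in F) (g x).2)).
    exists (\bigcup_(x in F) (g x).1), (\bigcup_(x in F) (g x).2); split => //.
    - by apply: clopen_bigcup => // x _; have [] := gP x.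
    - by apply: clopen_bigcup => // x _; have [] := gP x.
    - by move=> y [x _]; have [_ _ gO _ _] := gP x => /gO.
    - by move=> y [x _]; have [_ _ _ gO _] := gP x => /gO.
  by move=> x Fx; have [_ _ _ _ [gx|gx]] := gP x; [left|right]; exists x.
have /countable_injP[idx idx_inj] := Vcount.
have /choice[P PP] n : exists P : set X * set X, [/\ clopen P.1, clopen P.2,
    P.1 `<=` O1, P.2 `<=` O2 & forall E, V E -> idx E = n -> E `<=` P.1 `|` P.2].
  have [[E [VE En]]|nE] := pselect (exists E, V E /\ idx E = n); last first.
    exists (set0, set0); split => //=; [exact: clopen0|exact: clopen0|].
    by move=> E VE En; case: nE; exists E.
  have [C1 [C2 [C1clopen C2clopen C1O C2O EC]]] := VU E VE.
  exists (C1, C2); split => //= E' VE' E'n.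
  by rewrite -EC (idx_inj E E') ?inE// En.
pose A n := (P n).1 `|` (P n).2.
have coverA x : exists n, A n x.
  have [E VE Ex] := Vcov _ (finite_set1 x); exists (idx E).
  by have [_ _ _ _ EP] := PP (idx E); apply: (EP E) => //; exact: Ex.
have Aclopen n : clopen (A n) by have [? ? _ _ _] := PP n; exact: clopenU.
have Dclopen n : clopen (seqDU A n).
  rewrite /seqDU setDE; apply: clopenI => //.
  apply: clopenC; first exact: set0.
  by rewrite -bigcup_mkord; apply: clopen_bigcup => //; exact: finite_II.
have coverD : \bigcup_n seqDU A n = [set: X].
  rewrite -seqDU_bigcup_eq; apply/seteqP; split => // x _.
  by have [n] := coverA x; exists n.
pose C := \bigcup_n ((P n).1 `&` seqDU A n).
(* The complement is also a union of open sets, so [C] is closed although it is an infinite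
   union. *)
have CC : ~` C = \bigcup_n (~` (P n).1 `&` seqDU A n).
  apply/seteqP; split => [x nCx|x [n _ [nPx Dx]] [m _ [Px D'x]]].
    have [n _ Dx] : (\bigcup_n seqDU A n) x by rewrite coverD.
    by exists n => //; split => // Px; apply: nCx; exists n.
  suff mn : m = n by rewrite mn in Px.
  by apply: (trivIset_seqDU A) => //; exists x.
exists C; split.
- split.
    apply: bigcup_open => n _; apply: openI; last by have [] := Dclopen n.
    by have [[]] := PP n.
  rewrite -openC CC; apply: bigcup_open => n _.
  apply: openI; last by have [] := Dclopen n.
  by rewrite openC; have [[]] := PP n.
- by move=> x [n _ [Px _]]; have [_ _ PO _ _] := PP n; exact: PO.
- rewrite CC => x [n _ [nPx [Ax _]]]; have [_ _ _ PO _] := PP n; apply: PO.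
  by case: Ax.
Qed.

(** * The function space and its Reznichenko property *)

Section function_space.
Context {R : realType} {X : topologicalType}.
Implicit Types (y g : Cp X R) (F : set X) (e : R).

Local Open Scope ring_scope.

Definition Cp_val (g : Cp X R) : X -> R := set_val g.

Lemma Cp_val_continuous g : continuous (Cp_val g).
Proof. exact: (set_valP g). Qed.

Lemma Cp_val_inj : injective Cp_val.
Proof. by move=> f g /val_inj. Qed.

Lemma Cp_val_surj {f : X -> R} : continuous f -> exists g, Cp_val g = f.
Proof.
move=> fcont; exists (exist _ (f : {ptws X -> R}) (mem_set fcont)).
by [].
Qed.

Definition Cp_ball y F e : set (Cp X R) :=
  [set g | forall x, F x -> `|Cp_val g x - Cp_val y x| < e].

(** The product topology is a supremum over the coordinates, so convergence of the filter generated
    by these sets is checked at one coordinate, with [F] a singleton. *)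
Lemma nbhs_ptws {f : {ptws X -> R}} {W : set {ptws X -> R}} : nbhs f W ->
  exists F e, [/\ finite_set F, 0 < e &
    [set k : {ptws X -> R} | forall x, F x -> `|k x - f x| < e] `<=` W].
Proof.
pose E (Fe : set X * R) : set {ptws X -> R} :=
  [set k | forall x, Fe.1 x -> `|k x - f x| < Fe.2].
pose D : set (set X * R) := [set Fe | finite_set Fe.1 /\ 0 < Fe.2].
have filterD : Filter (filter_from D E).
  apply: filter_from_filter.
    by exists (set0, 1); split => //=; exact: ltr01.
  move=> [F1 e1] [F2 e2] [/= F1fin e1_gt0] [/= F2fin e2_gt0].
  exists (F1 `|` F2, Num.min e1 e2).
    by split => /=; [rewrite finite_setU|rewrite lt_min e1_gt0].
  move=> k /= kF; split => x /= Fx.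
    by have := kF x (or_introl Fx); rewrite lt_min => /andP[].
  by have := kF x (or_intror Fx); rewrite lt_min => /andP[].
suff : filter_from D E --> f.
  by move=> cvgf /cvgf[[F e] [/= Ffin e_gt0] EW]; exists F, e.
apply/cvg_sup => x A [_ [[B Bopen <-] /= Bfx BA]].
have /nbhs_ballP[e /= e_gt0 eB] : nbhs (f x) B by exact: open_nbhs_nbhs.
exists ([set x], e); first by split => //=; exact: finite_set1.
move=> k /= kx; apply: BA; apply: eB.
by rewrite /ball /= distrC; exact: kx.
Qed.

Lemma nbhs_Cp_ball {y} {N : set (Cp X R)} : nbhs y N ->
  exists F e, [/\ finite_set F, 0 < e & Cp_ball y F e `<=` N].
Proof.
move=> [_ [[W Wopen <-] /= Wy WN]].
have [F [e [Ffin e_gt0 FW]]] := nbhs_ptws (open_nbhs_nbhs (conj Wopen Wy)).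
by exists F, e; split => // g gF; apply: WN; exact: FW.
Qed.

Lemma Cp_ball_nbhs {y F e} : finite_set F -> 0 < e -> nbhs y (Cp_ball y F e).
Proof.
move=> Ffin e_gt0.
suff : nbhs y (\bigcap_(x in F)
    [set g : Cp X R | `|Cp_val g x - Cp_val y x| < e]) by [].
move/finite_fsetP: Ffin => [D ->]; apply: filter_bigI => x _.
have /(_ y) : continuous (fun g : Cp X R => Cp_val g x).
  move=> g; apply: (@continuous_comp _ _ _ (set_val : Cp X R -> {ptws X -> R})
    (fun k => k x)); first exact: initial_continuous.
  exact: (@proj_continuous X (fun _ => R) x).
move/cvgrPdist_lt => /(_ e e_gt0); apply: filterS => g /=.
by rewrite distrC.
Qed.

Lemma reznichenko_clopen_groups : Reznichenko (Cp X R) -> clopen_groups X.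
Proof.
move=> rezX U [[UT Ucov] Uclopen].
pose ind (V : set X) (x : X) : R := (~~ `[< V x >])%:R.
have ind_cont V : clopen V -> continuous (ind V).
  move=> Vclopen; have Vb : continuous (fun x => `[< V x >]).
    apply: continuous_bool; rewrite (_ : [set x | _] = V)//.
    by apply/seteqP; split => x /asboolP.
  move=> x; apply: (@continuous_comp _ _ _ (fun x => `[< V x >])
    (fun b : bool => (~~ b)%:R : R)); first exact: Vb.
  by move: (`[< _ >]); apply/continuousP => B _; exact: discrete_open.
have ind0 V x : ind V x = 0 <-> V x.
  rewrite /ind; split => [|/asboolP -> //].
  by case: asboolP => // _ /eqP; rewrite oner_eq0.
have [y y0] := @Cp_val_surj (fun=> 0) (fun x => cvg_cst _).
pose A := [set g | exists2 V, U V & Cp_val g = ind V].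
have [|[V UV yV]|F [Ftriv Ffin Fhit]] := rezX A y.
- move=> N /nbhs_Cp_ball[F [e [Ffin e_gt0 FN]]].
  have [V UV FV] := Ucov F Ffin.
  have [g gV] := Cp_val_surj (ind_cont V (Uclopen V UV)).
  exists g; split; first by exists V.
  apply: FN => x Fx; rewrite gV y0 subr0.
  by have /ind0 -> := FV x Fx; rewrite normr0.
- apply: UT; rewrite (_ : setT = V)//; apply/seteqP; split => // x _.
  by apply/ind0; rewrite -yV y0.
pose G n := [set V | U V /\ exists2 g, F n g & Cp_val g = ind V].
exists G; split.
- move=> m n _ _ [V [[_ [g Fg gV]] [_ [g' Fg' g'V]]]].
  apply: Ftriv => //; exists g; split => //.
  by rewrite (_ : g = g')//; apply: Cp_val_inj; rewrite gV.
(* A member of [G n] is the zero set of its function in [F n], so finiteness passes to [G n]. *)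
- move=> n; apply: (sub_finite_set _
    (finite_image (fun g : Cp X R => [set x | Cp_val g x = 0]) (Ffin n).1)).
  move=> V [_ [g Fg gV]]; exists g => //.
  by apply/seteqP; split => x /=; rewrite gV => /ind0.
- by move=> n V [].
(* Indicators take only the values 0 and 1, so radius 1 forces [E] inside [V]. *)
move=> E Efin; have [N _ NP] := Fhit _ (Cp_ball_nbhs (y := y) Efin ltr01).
exists N => // n /NP[g [gE Fg]].
have [V UV gV] := (Ffin n).2 _ Fg.
exists V; first by split => //; exists g.
move=> x /gE; rewrite gV y0 subr0 /ind; case: asboolP => // _.
by rewrite normr1 ltxx.
Qed.

Context (X_zero_dim : has_clopen_base X) (countX : countable_omega_subcovers X).

Lemma clopen_approximation {f g : X -> R} : continuous f -> continuous g ->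
  exists C : nat -> set X, [/\ forall m, clopen (C m),
    forall m x, C m x -> `|f x - g x| < m.+1%:R^-1 &
    forall m x, `|f x - g x| < m.+2%:R^-1 -> C m x].
Proof.
move=> fcont gcont.
have dist_cont : continuous (fun x => `|f x - g x|).
  by move=> x; apply: cvg_norm; apply: cvgB; [exact: fcont|exact: gcont].
have /choice[C CP] m : exists C, [/\ clopen C,
    C `<=` [set x | `|f x - g x| < m.+1%:R^-1] &
    ~` C `<=` [set x | m.+2%:R^-1 < `|f x - g x|]].
  apply: clopen_separation => //.
  - rewrite -[X in open X]/((fun x => `|f x - g x|) @^-1` [set r | r < m.+1%:R^-1]).
    by apply: open_comp => //; exact: open_lt.
  - rewrite -[X in open X]/((fun x => `|f x - g x|) @^-1` [set r | m.+2%:R^-1 < r]).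
    by apply: open_comp => //; exact: open_gt.
  - apply/seteqP; split => // x _.
    have [lt1|ge1] := ltP `|f x - g x| m.+1%:R^-1; first by left.
    right; apply: lt_le_trans ge1.
    by rewrite ltf_pV2 ?posrE ?ltr0n// ltr_nat.
exists C; split => [m|m x|m x fgx]; first by have [] := CP m.
  by have [_ CO _] := CP m => /CO.
have [_ _ CO] := CP m; apply: contrapT => /CO/= /lt_trans/(_ fgx).
by rewrite ltxx.
Qed.

(** For fixed [m], the sets [C f m] with [f] in [A] catch all finite sets, and a countable
    omega-subcover selects countably many [f]. Letting [m] vary handles all radii. *)
Lemma countable_tightness {A : set (Cp X R)} {y} : closure A y ->
  exists B, [/\ B `<=` A, countable B & closure B y].
Proof.
move=> Ay.
have /choice[C CP] (f : Cp X R) :=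
  clopen_approximation (Cp_val_continuous f) (Cp_val_continuous y).
have invS_lt e : 0 < e -> exists m, m.+1%:R^-1 < e.
  by move=> /ltr_add_invr[m]; rewrite add0r; exists m.
have /choice[B BP] m : exists B, [/\ B `<=` A, countable B &
    forall F, finite_set F -> exists2 f, B f & F `<=` C f m].
  (* If some [C f m] is the whole space the family is no omega-cover, but that [f] alone
     suffices. *)
  have [[f Af CfT]|CT] := pselect (exists2 f, A f & C f m = setT).
    exists [set f]; split => [_ ->//||F _]; first exact: countable1.
    by exists f; rewrite ?CfT.
  have [|V [VU Vcount [_ Vcov]]] := countX [set C f m | f in A].
    split; last by move=> _ [f _ <-]; have [] := CP f.
    split; first by move=> [f Af CfT]; apply: CT; exists f.
    move=> F Ffin.
    have [|f [Af fF]] := Ay (Cp_ball y F m.+2%:R^-1).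
      by apply: Cp_ball_nbhs => //; rewrite invr_gt0 ltr0n.
    exists (C f m); first by exists f.
    by move=> x /fF; have [_ _ C2] := CP f; exact: C2.
  have /choice[g gP] E : exists f, V E -> A f /\ C f m = E.
    have [/VU[f Af <-]|nVE] := pselect (V E); first by exists f.
    by exists y.
  exists (g @` V); split.
  - by move=> _ [E /gP[Ag _] <-].
  - exact: (sub_countable (card_image_le _ _)).
  - move=> F /Vcov[E VE FE]; exists (g E); first by exists E.
    by have [_ ->] := gP E VE.
exists (\bigcup_m B m); split.
- by move=> f [m _]; have [BA _ _] := BP m; exact: BA.
- by apply: bigcup_countable => // m _; have [] := BP m.
move=> N /nbhs_Cp_ball[F [e [Ffin e_gt0 FN]]]; have [m me] := invS_lt e e_gt0.
have [_ _ /(_ F Ffin)[f Bf FC]] := BP m.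
exists f; split; first by exists m.
by apply: FN => x /FC; have [_ C1 _] := CP f => /C1/lt_trans; apply.
Qed.

(** A function [d] other than [y] differs from it at some [x], and the ball at [x] whose radius is
    their distance there omits [d]. *)
Lemma closure_setD_finite {B D : set (Cp X R)} {y} :
  finite_set D -> ~ D y -> closure B y -> closure (B `\` D) y.
Proof.
move=> Dfin Dy By N yN.
have neq_nbhs d : d <> y -> nbhs y [set g | g <> d].
  move=> dy; have [x dx] : exists x, Cp_val d x <> Cp_val y x.
    by apply/existsNP => dxy; apply/dy/Cp_val_inj/funext.
  have dx_gt0 : 0 < `|Cp_val d x - Cp_val y x|.
    by rewrite normr_gt0 subr_eq0; exact/eqP.
  apply: filterS (Cp_ball_nbhs (finite_set1 x) dx_gt0) => g gx gd.
  by have := gx x erefl; rewrite gd ltxx.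
have yD : nbhs y (\bigcap_(d in D) [set g | g <> d]).
  move/finite_fsetP: Dfin Dy => [E ->] Ey; apply: filter_bigI => d dE.
  by apply: neq_nbhs => dy; apply: Ey; rewrite -dy.
have [f [Bf [Nf Df]]] := By _ (filterI yN yD); exists f; split => //.
by split => // /Df.
Qed.

Lemma clopen_blocks_Reznichenko : clopen_blocks X -> Reznichenko (Cp X R).
Proof.
move=> blocksX A y Ay nAy.
have [B [BA Bcount By]] := countable_tightness Ay.
have nBy : ~ B y by move=> /BA.
have Binf : infinite_set B.
  move=> Bfin; have [f [[Bf nBf] _]] := closure_setD_finite Bfin nBy By _ filterT.
  exact: nBf.
have [f_ f_inj f_B] := countable_infinite_enum Bcount Binf.
have /choice[C CP] (f : Cp X R) :=
  clopen_approximation (Cp_val_continuous f) (Cp_val_continuous y).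
have /choice[h_ h_P] m : exists h, {homo h : m n / (m < n)%N} /\
    eventually_hits (blocks (fun j => C (f_ j) m) h).
  apply: blocksX => [j|F p Ffin]; first by have [] := CP (f_ j).
  (* Removing the first [p] functions keeps [y] in the closure and yields an index at least [p]. *)
  have Dfin := finite_image f_ (finite_II p).
  have nDy : ~ (f_ @` `I_p) y.
    by move=> [j _ fy]; apply: nBy; rewrite -f_B; exists j.
  have [|f [[Bf Df] fF]] := closure_setD_finite Dfin nDy By _
      (Cp_ball_nbhs (e := m.+2%:R^-1) Ffin _).
    by rewrite invr_gt0 ltr0n.
  move: Bf Df fF; rewrite -f_B => -[j _ <-] Dj fF; exists j.
    by rewrite leqNgt; apply/negP => jp; apply: Dj; exists j.
  by move=> x /fF; have [_ _ C2] := CP (f_ j); exact: C2.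
(* each block of [h] contains a late block of [h_ m] for every [m <= n] *)
have [|h [h_homo hP]] := @homo_seq (fun n p q => forall m, (m <= n)%N ->
    exists k, [/\ (n <= k)%N, (p <= h_ m k)%N & (h_ m k.+1 <= q)%N]).
  move=> n p.
  have [q qP] := finite_nat_ubound
    (finite_image (fun m => h_ m (maxn n p).+1) (finite_II n.+1)).
  (* Block [maxn n p] of [h_ m] starts at [p] or later, since [h_ m k] is at least [k]; [q] exceeds
     its end for all [m <= n]. *)
  exists (maxn p.+1 q); split; first by rewrite leq_max leqnn.
  move=> m mn; exists (maxn n p); split; first by rewrite leq_maxl.
    have [h_m_homo _] := h_P m.
    by apply: leq_trans (homo_ltn_leq h_m_homo _); rewrite leq_maxr.
  by rewrite leq_max (ltnW (qP _ _)) ?orbT//; exists m.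
exists (fun n => f_ @` [set j | (h n <= j < h n.+1)%N]); split.
- have h_le := ltW_homo h_homo.
  have disj m n : (m < n)%N -> forall i, (i < h m.+1)%N -> (h n <= i)%N -> False.
    move=> mn i im ni; have := leq_trans im (leq_trans (h_le _ _ mn) ni).
    by rewrite ltnn.
  move=> m n _ _ [_ [[i /andP[mi im] <-] [j /andP[nj jn] /f_inj ij]]].
  rewrite {j}ij in nj jn; case: (ltngtP m n) => // mn.
    by have := disj m n mn i im nj.
  by have := disj n m mn i jn mi.
- move=> n; split.
    apply: finite_image; apply: (sub_finite_set _ (finite_II (h n.+1))).
    by move=> j /= /andP[].
  by move=> _ [j _ <-]; apply: BA; rewrite -f_B; exists j.
move=> N /nbhs_Cp_ball[F [e [Ffin e_gt0 FN]]].
have [m] := ltr_add_invr e_gt0; rewrite add0r => me.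
have [K _ KP] := (h_P m).2 F Ffin.
(* Past [m], block [n] contains a block [k] of [h_ m]; past [K], that block catches [F], as [k] is
   at least [n]. *)
exists (maxn m K) => // n /=; rewrite geq_max => /andP[mn Kn].
have [k [nk hk kh]] := hP n m mn.
have [_ [j /andP[kj jk] <-] Fj] := KP _ (leq_trans Kn nk).
exists (f_ j); split.
  by apply: FN => x /Fj; have [_ C1 _] := CP (f_ j) => /C1/lt_trans; apply.
by exists j => //=; rewrite (leq_trans hk kj) (leq_trans jk kh).
Qed.

End function_space.

Theorem theorem19 (R : realType) (X : topologicalType)
    (X_zero_dim : has_clopen_base X) :
  let P1 := Reznichenko (Cp X R) in
  let P2 :=
    (forall U : set (set X), clopen_omega_cover U ->
       exists V : set (set X), [/\ V `<=` U, countable V & omega_cover V]) /\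
    ~ (exists (Psi : X -> infinite_subsets) (F : set (set nat)),
         [/\ continuous Psi, nonprincipal_filter F, ~ feeble F &
             subbase_for (image_family Psi) F]) in
  let P3 :=
    forall U : set (set X), clopen_omega_cover U ->
      exists V : set (set X), V `<=` U /\ omega_groupable_cover V in
  (P1 <-> P2) /\ (P2 <-> P3).
Proof.
move=> P1 P2 P3.
have P12 : P2 -> P1.
  by move=> [countX /clopen_blocksP]; exact: clopen_blocks_Reznichenko.
have P13 : P1 -> P3.
  by move/reznichenko_clopen_groups; exact: groups_groupable.
have P32 : P3 -> P2.
  move=> groupableX; split; first exact: groupable_countable_omega.
  exact/clopen_blocks_feeble/groupable_clopen_blocks.
by split; split; [move/P13/P32|exact: P12|move/P12/P13|exact: P32].
Qed.
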